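(* Let $X\subset\mathbb{P}^N$ be a non-degenerate embedded toric variety. Then, for any $r \geq 2$, the $r$th $X$-Hadamard-rank is finite for any point in $\mathbb{P}^N$; that is, for every $p\in\mathbb{P}^N$ there exist $m\ge1$ and $q_1,\ldots,q_m\in\sigma_r(X)$ such that $p=q_1\star\cdots\star q_m$.
   Context: Homogeneous coordinates on $\mathbb{P}^N=\mathbb{P}^N_{\mathbb{C}}$ are fixed. An (embedded) toric variety is a positive-dimensional projective variety $X\subset\mathbb{P}^N$ that is the Zariski closure of the image of a monomial map $\varphi_A\colon(\mathbb{C}\smallsetminus\{0\})^{n+1}\to\mathbb{P}^N$, $\mathbf{x}\mapsto(\mathbf{x}^{\alpha_0}:\cdots:\mathbf{x}^{\alpha_N})$, where $A=(\alpha_0|\cdots|\alpha_N)\in\mathbb{Z}_{\ge0}^{(n+1)\times(N+1)}$ is a matrix whose columns all have the same coordinate sum $|\alpha_i|=|\alpha_j|$. It is non-degenerate if $\alpha_i\neq\alpha_j$ for all $i\neq j$. The $r$th secant variety $\sigma_r(X)$ is the Zariski closure of the union of the linear spans $\langle q_1,\ldots,q_r\rangle$ over $q_1,\ldots,q_r\in X$. The Hadamard product of points is $(p_0:\cdots:p_N)\star(q_0:\cdots:q_N)=(p_0q_0:\cdots:p_Nq_N)$, defined whenever the right-hand side is not identically zero. The $r$th $X$-Hadamard-rank of $p$ is the smallest $m\ge1$ such that $p=q_1\star\cdots\star q_m$ with all $q_i\in\sigma_r(X)$, and it is $\infty$ if no such expression exists. *)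

(* Defs.v *)
From HB Require Import structures.
From mathcomp Require Import all_boot all_order all_algebra.
From mathcomp Require Import generic_quotient.
From mathcomp Require Import boolp classical_sets reals complex mpoly.

Set Implicit Arguments.
Unset Strict Implicit.
Unset Printing Implicit Defensive.

Import GRing.Theory.
Local Open Scope ring_scope.
Local Open Scope classical_set_scope.
Local Open Scope quotient_scope.

Section ProjectiveSpace.
Variables (F : fieldType) (N : nat).

Definition nzvec := {v : 'rV[F]_N.+1 | v != 0}.

(* Equality of the row spaces, i.e. of the lines spanned in F^(N+1);
   see [proportionalP]. *)
Definition proportional (v w : nzvec) : bool := (val v == val w)%MS.

Lemma proportionalP (v w : nzvec) :
  reflect (exists2 l : F, l != 0 & val v = l *: val w) (proportional v w).
Proof.
apply: (iffP idP) => [/andP[/sub_rVP[l vE] _]|[l l0 vE]].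
  exists l => //; apply: contraNneq (valP v) => l0.
  by rewrite vE l0 scale0r.
apply/andP; split; first by rewrite vE scalemx_sub.
by apply/sub_rVP; exists l^-1; rewrite vE scalerA mulVf ?scale1r.
Qed.

Lemma proportional_refl : reflexive proportional.
Proof. by move=> v; rewrite /proportional !submx_refl. Qed.

Lemma proportional_sym (v w : nzvec) : proportional v w = proportional w v.
Proof. by rewrite /proportional andbC. Qed.

Lemma proportional_trans : transitive proportional.
Proof.
move=> v u w /andP[uv vu] /andP[vw wv].
by apply/andP; split; [exact: submx_trans uv vw | exact: submx_trans wv vu].
Qed.

Canonical proportional_equiv :=
  EquivRel proportional proportional_refl proportional_sym proportional_trans.

Definition projspace := {eq_quot proportional}.

(* A choice of homogeneous coordinates of p. *)
Definition hcoord (p : projspace) : 'rV[F]_N.+1 := val (repr p).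

(* The point (v_0 : ... : v_N), defined when v is not identically zero. *)
Definition mkpoint (v : 'rV[F]_N.+1) : option projspace :=
  omap \pi_projspace (insub v : option nzvec).

Lemma hcoord_neq0 (p : projspace) : hcoord p != 0.
Proof. exact: valP (repr p). Qed.

Lemma mkpointP (v : 'rV[F]_N.+1) (p : projspace) :
  mkpoint v = Some p <-> exists2 l : F, l != 0 & v = l *: hcoord p.
Proof.
rewrite /mkpoint; case: insubP => [u u0 uE|/negPn/eqP ->]; split=> //=.
- move=> [<-]; rewrite -uE; apply/proportionalP.
  by have /eqmodP := esym (reprK (\pi_projspace u)).
- move=> vE; congr Some; rewrite -[p]reprK; apply/eqmodP/proportionalP.
  by rewrite uE.
- move=> [l l0 /esym/eqP]; rewrite scaler_eq0 (negPf l0).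
  by rewrite (negPf (hcoord_neq0 p)).
Qed.

(* The common zeros of S; only meaningful for homogeneous polynomials. *)
Definition proj_zeros (S : set {mpoly F[N.+1]}) : set projspace :=
  [set p | forall f, S f -> f.@[fun i => hcoord p 0 i] = 0].

Definition zariski_closed (Z : set projspace) : Prop :=
  exists2 S : set {mpoly F[N.+1]},
    (forall f, S f -> exists d : nat, f \is d.-homog) & Z = proj_zeros S.

Definition zariski_closure (Y : set projspace) : set projspace :=
  [set p | forall Z, zariski_closed Z -> Y `<=` Z -> Z p].

Definition zariski_irreducible (Z : set projspace) : Prop :=
  Z !=set0 /\
  forall Z1 Z2, zariski_closed Z1 -> zariski_closed Z2 ->
    Z `<=` Z1 `|` Z2 -> Z `<=` Z1 \/ Z `<=` Z2.

Definition projective_variety (X : set projspace) : Prop :=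
  zariski_closed X /\ zariski_irreducible X.

(* Krull dimension: X contains a chain Z 0 < Z 1 < ... < Z d of varieties. *)
Definition dim_ge (d : nat) (X : set projspace) : Prop :=
  exists Z : nat -> set projspace,
    (forall i, (i <= d)%N -> projective_variety (Z i) /\ Z i `<=` X) /\
    (forall i, (i < d)%N -> Z i `<` Z i.+1).

Definition monomial_vec (n : nat) (A : 'M[nat]_(n.+1, N.+1))
    (x : 'rV[F]_n.+1) : 'rV[F]_N.+1 :=
  \row_j \prod_i x 0 i ^+ A i j.

Definition monomial_image (n : nat) (A : 'M[nat]_(n.+1, N.+1)) :
    set projspace :=
  [set p | exists2 x : 'rV[F]_n.+1,
     (forall i, x 0 i != 0) & mkpoint (monomial_vec A x) = Some p].

Definition toric_variety (n : nat) (A : 'M[nat]_(n.+1, N.+1))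
    (X : set projspace) : Prop :=
  [/\ projective_variety X,
      dim_ge 1 X,
      forall j k, (\sum_i A i j)%N = (\sum_i A i k)%N &
      X = zariski_closure (monomial_image A)].

Definition nondegenerate_mx (n : nat) (A : 'M[nat]_(n.+1, N.+1)) : Prop :=
  forall j k, j != k -> col j A <> col k A.

Definition linear_span (r : nat) (q : 'I_r -> projspace) : set projspace :=
  [set p | (hcoord p <= \matrix_(k < r) hcoord (q k))%MS].

Definition secant (r : nat) (X : set projspace) : set projspace :=
  zariski_closure
    [set p | exists2 q : 'I_r -> projspace,
       (forall k, X (q k)) & linear_span q p].

Definition hadamard (p q : projspace) : option projspace :=
  mkpoint (\row_j (hcoord p 0 j * hcoord q 0 j)).

(* The left-associated product of q_1, ..., q_m, for m > 0. *)
Definition hadamard_prod (qs : seq projspace) : option projspace :=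
  if qs is q :: s
  then foldl (fun o q' => obind (fun p => hadamard p q') o) (Some q) s
  else None.

Definition hadamard_decomp (r : nat) (X : set projspace) (p : projspace)
    (m : nat) : Prop :=
  (0 < m)%N /\
  exists2 q : m.-tuple projspace,
    (forall k, secant r X (tnth q k)) & hadamard_prod q = Some p.

(* None stands for the value infinity. *)
Definition hadamard_rank (r : nat) (X : set projspace) (p : projspace) :
    option nat :=
  if pselect (exists m, `[< hadamard_decomp r X p m >]) is left ex
  then Some (ex_minn ex) else None.

Lemma hadamard_rank_finite (r : nat) (X : set projspace) (p : projspace) :
  (exists m, hadamard_rank r X p = Some m) <->
  exists m, hadamard_decomp r X p m.
Proof.
rewrite /hadamard_rank; case: pselect => [ex|nex]; split=> [[m]|[m mP]] //.
- by have [k /asboolP kP] := ex; exists k.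
- by eexists.
- by case: nex; exists m; apply/asboolP.
Qed.

(* The definitions above do not depend on the chosen coordinates. *)

Lemma vanish_hcoord (d : nat) (f : {mpoly F[N.+1]}) (v : 'rV[F]_N.+1)
    (p : projspace) : f \is d.-homog -> mkpoint v = Some p ->
  (f.@[fun i => v 0 i] == 0) = (f.@[fun i => hcoord p 0 i] == 0).
Proof.
move=> /dhomogP fd /mkpointP[l l0 ->].
have -> : f.@[fun i => (l *: hcoord p) 0 i] =
    l ^+ d * f.@[fun i => hcoord p 0 i].
  rewrite !mevalE big_distrr /= big_seq [RHS]big_seq.
  apply: eq_bigr => m /fd /= <-; rewrite mulrCA; congr (_ * _).
  rewrite mdegE -prodrXr -big_split /=; apply: eq_bigr => i _.
  by rewrite mxE exprMn.
by rewrite mulf_eq0 expf_eq0 (negPf l0) andbF.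
Qed.

Lemma hadamard_mkpoint (v w : 'rV[F]_N.+1) (p q : projspace) :
  mkpoint v = Some p -> mkpoint w = Some q ->
  hadamard p q = mkpoint (\row_j (v 0 j * w 0 j)).
Proof.
move=> /mkpointP[l l0 ->] /mkpointP[k k0 ->].
have lk0 : l * k != 0 by rewrite mulf_neq0.
have -> : \row_j ((l *: hcoord p) 0 j * (k *: hcoord q) 0 j) =
    (l * k) *: \row_j (hcoord p 0 j * hcoord q 0 j).
  by apply/rowP => j; rewrite !mxE mulrACA.
rewrite /hadamard; set u := \row_j _.
have mkE s : mkpoint ((l * k) *: u) = Some s <-> mkpoint u = Some s.
  split=> /mkpointP[c c0 cE]; apply/mkpointP.
    exists ((l * k)^-1 * c); first by rewrite mulf_neq0 ?invr_eq0.
    by rewrite -scalerA -cE scalerA mulVf ?scale1r.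
  by exists (l * k * c); rewrite ?mulf_neq0 // cE scalerA.
case E1: (mkpoint u) => [s|]; first by apply/esym/mkE.
by case E2: (mkpoint _) => [s|] //; move/mkE: E2; rewrite E1.
Qed.

End ProjectiveSpace.

(* Main.v *)
Require Import Defs.
From mathcomp Require Import all_boot all_order all_algebra.
From mathcomp Require Import boolp classical_sets reals complex mpoly.

(** The line joining two points of [X] already suffices.  Pick a torus point
    [z] at which the monomials [w_j = z ^ alpha_j] are pairwise distinct, which
    is possible because the columns of [A] are.  Both [(1 : ... : 1)], the image
    of the unit of the torus, and [w] lie in [X], so every point of the line
    through them, in particular [(w_0 - a : ... : w_N - a)] for each scalar [a],
    lies in the [r]th secant variety as soon as [r >= 2].  A Hadamard product of
    such points is [(f(w_0) : ... : f(w_N))], where [f] is the monic polynomial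
    whose roots are the scalars [a] used.

    Conversely, given [p = (p_0 : ... : p_N)], Lagrange interpolation at the
    distinct nodes [w_j] yields a polynomial [f] with [f(w_j) = p_j], and over
    an algebraically closed field [f] is a constant times a product of factors
    [X - a].  Hence [p] is the Hadamard product of the points [w - a], where [a]
    runs over the roots of [f]; the extra factor [(1 : ... : 1)] makes
    the product nonempty when [f] is constant.

    The lemmas that carry the argument are [distinct_monomials], [interpolation],
    [secant_of_span2] and [hadamard_prod_mkpoint]. *)

Set Implicit Arguments.
Unset Strict Implicit.
Unset Printing Implicit Defensive.

Import GRing.Theory Num.Theory.
Local Open Scope ring_scope.

Lemma base_expansion_inj (M n : nat) (a b : 'I_n -> nat) :
  (forall i, a i < M)%N -> (forall i, b i < M)%N ->
  (\sum_i a i * M ^ i = \sum_i b i * M ^ i)%N -> a =1 b.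
Proof.
elim: n a b => [|n IHn] a b aM bM; first by move=> _ [].
have shift (c : 'I_n.+1 -> nat) : (\sum_i c i * M ^ i =
    (\sum_(i < n) c (lift ord0 i) * M ^ i) * M + c ord0)%N.
  rewrite big_ord_recl muln1 addnC big_distrl /=; congr (_ + _)%N.
  by apply: eq_bigr => i _; rewrite -mulnA -expnSr.
rewrite !shift => E.
have E0 : a ord0 = b ord0.
  by have := congr1 (modn^~ M) E; rewrite /= !modnMDl !modn_small.
have M0 : (0 < M)%N by apply: leq_ltn_trans (aM ord0).
move/eqP: E; rewrite E0 eqn_add2r eqn_pmul2r // => /eqP E i.
by case: (unliftP ord0 i) => [j|] -> //; apply: (IHn _ _ _ _ E) => k.
Qed.

(** Evaluating at [z_i = 2 ^ (M ^ i)] turns a monomial into [2] to the number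
    whose base-[M] digits are the exponents, so for [M] larger than all
    exponents distinct monomials take distinct values. *)
Lemma distinct_monomials (F : numFieldType) (N n : nat)
    (A : 'M[nat]_(n.+1, N.+1)) : nondegenerate_mx A ->
  exists2 z : 'rV[F]_n.+1, (forall i, z 0 i != 0) &
    injective (monomial_vec A z 0).
Proof.
move=> ndA; pose M := (\sum_i \sum_j A i j).+1.
have AM i j : (A i j < M)%N.
  by rewrite ltnS (bigD1 i) //= (bigD1 j) //= -addnA leq_addr.
exists (\row_i (2 ^ (M ^ i))%:R) => [i|j k].
  by rewrite mxE pnatr_eq0 expn_eq0.
have monE l : monomial_vec A (\row_i (2 ^ (M ^ i))%:R) 0 l =
    (2 ^ (\sum_i A i l * M ^ i))%:R :> F.
  rewrite mxE expn_sum natr_prod; apply: eq_bigr => i _.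
  by rewrite mxE -natrX -expnM mulnC.
rewrite !monE => /eqP; rewrite eqr_nat eqn_exp2l // => /eqP E.
have jk := base_expansion_inj (fun i => AM i j) (fun i => AM i k) E.
by apply: contrapT => /eqP/ndA; apply; apply/colP => i; rewrite !mxE.
Qed.

Lemma interpolation (F : fieldType) (n : nat) (w v : 'I_n -> F) :
  injective w -> exists f : {poly F}, forall j, f.[w j] = v j.
Proof.
move=> w_inj.
exists (\sum_i (v i / \prod_(k | k != i) (w i - w k)) *:
          \prod_(k | k != i) ('X - (w k)%:P)) => j.
rewrite horner_sum (bigD1 j) //= [X in _ + X]big1 ?addr0 => [|i ij].
  rewrite hornerZ horner_prod.
  under [X in _ * X]eq_bigr do rewrite hornerXsubC.
  rewrite divfK //; apply/prodf_neq0 => k kj.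
  by rewrite subr_eq0 (inj_eq w_inj) eq_sym.
rewrite hornerZ horner_prod [X in _ * X](bigD1 j) 1?eq_sym //=.
by rewrite hornerXsubC subrr mul0r mulr0.
Qed.

Section HadamardSecant.
Variables (F : fieldType) (N : nat).
Implicit Types (p q : projspace F N) (u v : 'rV[F]_N.+1).

Lemma mkpoint_hcoord p : mkpoint (hcoord p) = Some p.
Proof. by apply/mkpointP; exists 1; rewrite ?oner_eq0 ?scale1r. Qed.

Lemma mkpoint_neq0 v : v != 0 -> exists p, mkpoint v = Some p.
Proof. by rewrite /mkpoint => v0; rewrite insubT /=; eexists. Qed.

Lemma hcoord_mkpoint v p : mkpoint v = Some p -> (hcoord p :=: v)%MS.
Proof. by move=> /mkpointP[l l0 ->]; apply/eqmx_sym/eqmx_scale. Qed.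

Lemma subset_zariski_closure (Y : set (projspace F N)) p :
  Y p -> zariski_closure Y p.
Proof. by move=> Yp Z _; apply. Qed.

Lemma secant_of_span2 (r : nat) (X : set (projspace F N)) p1 p2 q :
  (2 <= r)%N -> X p1 -> X p2 -> (hcoord q <= hcoord p1 + hcoord p2)%MS ->
  secant r X q.
Proof.
case: r => [|[|r]] // _ X1 X2 q12; apply: subset_zariski_closure.
exists (fun k => if k == ord0 then p1 else p2); first by move=> k; case: ifP.
apply: submx_trans q12 _; set S := \matrix_k _.
rewrite addsmx_sub; apply/andP; split.
  by have := row_sub ord0 S; rewrite rowK.
by have := row_sub ord_max S; rewrite rowK.
Qed.

(** A coordinate at which no factor vanishes keeps every partial product
    nonzero, so that the iterated Hadamard product is defined. *)
Lemma hadamard_prod_mkpoint (j : 'I_N.+1) v (us : seq 'rV[F]_N.+1) p :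
  mkpoint v = Some p -> v 0 j != 0 -> (forall u, u \in us -> u 0 j != 0) ->
  hadamard_prod (p :: pmap (@mkpoint F N) us) =
    mkpoint (\row_k (v 0 k * \prod_(u <- us) u 0 k)).
Proof.
rewrite /=; elim: us v p => [|u us IHus] v p vp vj usj /=.
  rewrite -vp; congr mkpoint; apply/rowP => k.
  by rewrite !mxE big_nil mulr1.
have uj : u 0 j != 0 by apply: usj; rewrite mem_head.
have nz (x : 'rV[F]_N.+1) : x 0 j != 0 -> x != 0.
  by apply: contraNneq => ->; rewrite mxE.
have [q uq] := mkpoint_neq0 (nz _ uj).
pose v' : 'rV[F]_N.+1 := \row_k (v 0 k * u 0 k).
have v'j : v' 0 j != 0 by rewrite mxE mulf_neq0.
have [p' v'p'] := mkpoint_neq0 (nz _ v'j).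
rewrite uq /= (hadamard_mkpoint vp uq) v'p' (IHus v') //.
  by congr mkpoint; apply/rowP => k; rewrite !mxE big_cons mulrA.
by move=> x xus; apply: usj; rewrite inE xus orbT.
Qed.

End HadamardSecant.

(** A polynomial that interpolates [p] at the coordinates [v_j] of [w] splits
    into linear factors, and the values [v_j - a] of each factor are the
    coordinates of a point on the line joining [e] and [w]; the leading
    coefficient is lost in the homogeneous coordinates. *)
Lemma hadamard_decomp_of_line (F : closedFieldType) (N r : nat)
    (X : set (projspace F N)) (e w : projspace F N) (v : 'rV[F]_N.+1) :
  (2 <= r)%N -> X e -> X w -> mkpoint (const_mx 1) = Some e ->
  mkpoint v = Some w -> injective (v 0) ->
  forall p, exists m, hadamard_decomp r X p m.
Proof.
move=> r2 Xe Xw eE wE v_inj p.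
have [f fE] := interpolation (hcoord p 0) v_inj.
have [s sE] := closed_field_poly_normal f.
have pE j : hcoord p 0 j = lead_coef f * \prod_(a <- s) (v 0 j - a).
  rewrite -fE {1}sE hornerZ horner_prod; congr (_ * _).
  by apply: eq_bigr => a _; rewrite hornerXsubC.
have /rV0Pn[j pj] := hcoord_neq0 p.
move: pj; rewrite pE mulf_eq0 negb_or => /andP[f0 sj].
pose us := [seq v - const_mx a | a <- s].
have usj u : u \in us -> u 0 j != 0.
  case/mapP => a sa ->; rewrite !mxE.
  by move: sj; rewrite prodf_seq_neq0 => /allP/(_ a sa).
pose qs := e :: pmap (@mkpoint F N) us.
exists (size qs); split=> //; exists (in_tuple qs) => [k|].
  have : tnth (in_tuple qs) k \in qs by apply: mem_tnth.
  move: (tnth _ _) => q; rewrite inE => /predU1P[->|].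
    by apply: (secant_of_span2 r2 Xe Xe); apply: addsmxSl.
  rewrite mem_pmap => /mapP[u /mapP[a _ ->] /esym qE].
  apply: (secant_of_span2 r2 Xw Xe); rewrite (hcoord_mkpoint qE).
  rewrite (adds_eqmx (hcoord_mkpoint wE) (hcoord_mkpoint eE)).
  have -> : const_mx a = a *: const_mx 1 :> 'rV[F]_N.+1.
    by apply/rowP => i; rewrite !mxE mulr1.
  by rewrite addmx_sub_adds // -scaleNr scalemx_sub.
have ej : (const_mx 1 : 'rV[F]_N.+1) 0 j != 0 by rewrite mxE oner_eq0.
rewrite [LHS](hadamard_prod_mkpoint eE ej usj).
apply/mkpointP; exists (lead_coef f)^-1; rewrite ?invr_eq0 //.
apply/rowP => k; rewrite !mxE pE mulKf // mul1r big_map.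
by apply: eq_bigr => a _; rewrite !mxE.
Qed.

Theorem corollary3p8 (R : realType) (N n : nat) (A : 'M[nat]_(n.+1, N.+1))
    (X : set (projspace R[i] N)) :
  toric_variety A X -> nondegenerate_mx A ->
  forall r : nat, (2 <= r)%N ->
  forall p : projspace R[i] N, exists m : nat, hadamard_rank r X p = Some m.
Proof.
move=> [_ _ _ XE] ndA r r2 p; apply/hadamard_rank_finite.
have imX (x : 'rV[R[i]]_n.+1) q : (forall i, x 0 i != 0) ->
    mkpoint (monomial_vec A x) = Some q -> X q.
  by move=> x0 xq; rewrite XE; apply: subset_zariski_closure; exists x.
have point (x : 'rV[R[i]]_n.+1) : (forall i, x 0 i != 0) ->
    exists q, mkpoint (monomial_vec A x) = Some q.
  move=> x0; apply: mkpoint_neq0; apply/rV0Pn; exists ord0; rewrite mxE.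
  by apply/prodf_neq0 => i _; rewrite expf_neq0.
have [z z0 z_inj] := distinct_monomials R[i] ndA.
have [w wE] := point z z0.
have one0 i : (const_mx 1 : 'rV[R[i]]_n.+1) 0 i != 0 by rewrite mxE oner_eq0.
have [e eE] := point _ one0.
apply: (hadamard_decomp_of_line r2 (imX _ _ one0 eE) (imX _ _ z0 wE) _ wE z_inj).
rewrite -eE; congr mkpoint; apply/rowP => j; rewrite !mxE big1 // => i _.
by rewrite mxE expr1n.
Qed.
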